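(* Let $(G,\pi)$ be a parity game, $\tau$ a strategy for Odd, $T$ an $(n,d/2)$-universal tree, and $\mu:V\to\bar L(T)$ a node labeling such that $G_\tau$ has no loose arcs with respect to $\mu$. Consider the procedure BellmanFord which, given a node labeling $\nu$, repeats $n-1$ times: for every arc $vw\in E_\tau$ (in any order) set $\nu(v):=\mathrm{drop}(\nu,vw)$; and then returns $\nu$. If the input $\nu:V\to\bar L(T)$ satisfies $\nu\ge\mu^{\mathcal{G}^\uparrow_\tau}$ and $\nu(v)\le\widehat{\mu}(v)$ for all $v\in B(G_\tau)$, then BellmanFord returns $\mu^{\mathcal{G}^\uparrow_\tau}$.
   Context: A parity game: finite directed graph $G=(V,E)$, every node with an outgoing arc, $V=V_0\sqcup V_1$ (Even's and Odd's nodes), priorities $\pi:V\to\{1,\dots,d\}$, $d$ even, $n=|V|$. A strategy for Odd is $\tau:V_1\to V$ with $v\tau(v)\in E$; $G_\tau=(V,E_\tau)$ with $E_\tau=\{vw\in E:v\in V_0\}\cup\{v\tau(v):v\in V_1\}$. A strategy for Even is $\sigma:V_0\to V$ with $v\sigma(v)\in E$; $G_\sigma$ keeps all arcs out of $V_1$ and only $v\sigma(v)$ out of $v\in V_0$. For a subgraph $H$, $\pi(H)$ is the maximum priority in $H$, $H$ is even if $\pi(H)$ is even, $\Pi(H)$ is the set of nodes of $H$ with priority $\pi(H)$, and $v$ dominates $H$ if $v\in\Pi(H)$. Ordered trees: prefix-closed sets of tuples over a linearly ordered set, viewed as rooted trees, ordered lexicographically; in a tree of height $h$ all leaves have depth $h$,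 a leaf is $\xi=(\xi_{2h-1},\dots,\xi_1)$ and its $p$-truncation $\xi|_p$ deletes the components with index $<p$. $L(T)$ = leaves, $\bar L(T)=L(T)\cup\{\top\}$ with $\top$ maximal and $\top|_p=\top$. An $(\ell,h)$-universal tree is an ordered tree of height $h$ into which every ordered tree of height $h$ with at most $\ell$ leaves (all at depth $h$) embeds by an injective, edge-preserving, order-preserving, leaf-to-leaf map. A node labeling is $\mu:V\to\bar L(T)$, ordered pointwise. An arc $vw$ is non-violated w.r.t. $\mu$ if ($\pi(v)$ even and $\mu(v)|_{\pi(v)}\ge\mu(w)|_{\pi(v)}$) or ($\pi(v)$ odd and ($\mu(v)|_{\pi(v)}>\mu(w)|_{\pi(v)}$ or $\mu(v)=\mu(w)=\top$)); otherwise violated. It is tight if $\mu(v)$ is the smallest $\xi\in\bar L(T)$ such that $vw$ is non-violated after replacing $\mu(v)$ by $\xi$; loose if neither tight nor violated. $\mu$ is feasible in a subgraph $H$ if there is an Even strategy $\sigma$ with $v\sigma(v)\in E(H)$ for every $v\in V_0$ with an outgoing arc in $H$ such that all arcs of $H$ in $G_\sigma$ are non-violated. $\mu^{\mathcal{G}^\uparrow_\tau}$ is the pointwise least node labeling $\nu\ge\mu$ feasible in $G_\tau$ (it exists). For a labeling $\nu$ and arc $vw$, $\mathrm{drop}(\nu,vw)$ is the largest $\xi\in\bar L(T)$ with $\xi\le\nu(v)$ such that $vw$ is not loose after replacing $\nu(v)$ by $\xi$. A base node of $G_\tau$ is a node $v$ with $v\in\Pi(C)$ for some even cycle $C$ of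 $G_\tau$; $B(G_\tau)$ is the set of base nodes. The threshold label of $v\in B(G_\tau)$ is $\widehat{\mu}(v):=\min\{\tilde\mu(v):\tilde\mu:V\to\bar L(T),\ \tilde\mu(v)\ge\mu(v),\ \tilde\mu\text{ is feasible in some cycle dominated by }v\text{ in }G_\tau\}$. *)

(* Defs.v *)
From HB Require Import structures.
From mathcomp Require Import all_boot all_order.
From mathcomp Require Import boolp classical_sets functions cardinality.

Set Implicit Arguments.
Unset Strict Implicit.
Unset Printing Implicit Defensive.

Import Order.TTheory.

Local Open Scope order_scope.

Definition withtop (T : Type) := option T.

Section WithTop.
Context (disp : Order.disp_t) (T : orderType disp).

HB.instance Definition _ := Choice.copy (withtop T) (option T).

Definition withtop_le (x y : withtop T) : bool :=
  match x, y with
  | _, None => true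
  | None, Some _ => false
  | Some a, Some b => a <= b
  end.

Fact withtop_le_refl : reflexive withtop_le.
Proof. by case=> //= a; exact: lexx. Qed.

Fact withtop_le_anti : antisymmetric withtop_le.
Proof. by case=> [a|] [b|] //= /le_anti ->. Qed.

Fact withtop_le_trans : transitive withtop_le.
Proof. by case=> [b|] [a|] [c|] //=; exact: le_trans. Qed.

HB.instance Definition _ := Order.Le_isPOrder.Build disp (withtop T)
  withtop_le_refl withtop_le_anti withtop_le_trans.

Fact withtop_le_total : total (<=%O : rel (withtop T)).
Proof. by case=> [a|] [b|] //; exact: le_total. Qed.

HB.instance Definition _ :=
  Order.POrder_isTotal.Build disp (withtop T) withtop_le_total.

Fact withtop_lex1 (x : withtop T) : x <= None.
Proof. by case: x. Qed.

HB.instance Definition _ := Order.hasTop.Build disp (withtop T) withtop_lex1.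

End WithTop.

Definition is_least disp (T : porderType disp) (P : T -> Prop) (x : T) : Prop :=
  P x /\ forall y, P y -> x <= y.

Definition is_greatest disp (T : porderType disp) (P : T -> Prop) (x : T) :
    Prop :=
  P x /\ forall y, P y -> y <= x.

(* The nodes of an ordered tree are tuples over [M], compared                 *)
(* lexicographically (a proper prefix is smaller); the root is [[::]].        *)
Section OrderedTree.
Context (disp : Order.disp_t) (M : orderType disp).
Implicit Types (T : set (seqlexi M)) (s t : seqlexi M).

Definition ordered_tree T : Prop :=
  T [::] /\ forall s1 s2 : seq M, T (s1 ++ s2) -> T s1.

Definition tree_edge s t : Prop := exists a : M, t = rcons s a.

Definition leaf T s : Prop := T s /\ forall t, T t -> ~ tree_edge s t.

(* The bound on all nodes rules out infinite branches. *)
Definition tree_of_height (h : nat) T : Prop :=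
  [/\ ordered_tree T,
      forall s, T s -> (size s <= h)%N &
      forall s, leaf T s -> size s = h].

Record leaf_of T := Leaf {
  leaf_val : seqlexi M;
  leaf_valP : `[< leaf T leaf_val >]
}.

HB.instance Definition _ T := [isSub for @leaf_val T].
HB.instance Definition _ T := [Choice of leaf_of T by <:].
HB.instance Definition _ T := [SubChoice_isSubOrder of leaf_of T by <:
  with Order.seqlexi_display disp].

Definition label T := withtop (leaf_of T).

(* A leaf of a tree of height [h] is (xi_(2h-1), xi_(2h-3), ..., xi_1), so the *)
(* number of components with index at least [p] is (2h + 1 - p) / 2.          *)
Definition trunc (h p : nat) T (xi : label T) : withtop (seqlexi M) :=
  omap (fun s : leaf_of T => take (h.*2.+1 - p)./2 (leaf_val s)) xi.

End OrderedTree.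

Definition tree_embedding disp1 (M1 : orderType disp1) disp2
    (M2 : orderType disp2) (T1 : set (seqlexi M1)) (T2 : set (seqlexi M2))
    (f : seqlexi M1 -> seqlexi M2) : Prop :=
  [/\ set_fun T1 T2 f,
      set_inj T1 f,
      forall s t, T1 s -> T1 t -> tree_edge s t -> tree_edge (f s) (f t),
      forall s t, T1 s -> T1 t -> s <= t -> f s <= f t &
      forall s, leaf T1 s -> leaf T2 (f s)].

Definition universal_tree (l h : nat) disp (M : orderType disp)
    (T : set (seqlexi M)) : Prop :=
  tree_of_height h T /\
  forall disp' (M' : orderType disp') (T' : set (seqlexi M')),
    tree_of_height h T' -> ([set s | leaf T' s]%classic #<= `I_l)%card ->
    exists f, tree_embedding T' T f.

Record parity_game := ParityGame {
  node : finType;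
  arc : rel node;
  even_node : {set node};
  prio : node -> nat;
  maxprio : nat;
  arc_total : forall v, exists w, arc v w;
  maxprio_even : ~~ odd maxprio;
  prio_bound : forall v, (1 <= prio v <= maxprio)%N
}.

Section Game.
Context (G : parity_game).
Notation V := (node G).
Implicit Types (v w : V) (c : seq V).

(* Values of [tau] on Even's nodes, and of [sigma] on Odd's, are irrelevant. *)
Definition odd_strategy (tau : V -> V) : Prop :=
  forall v, v \notin even_node G -> arc v (tau v).

Definition even_strategy (sigma : V -> V) : Prop :=
  forall v, v \in even_node G -> arc v (sigma v).

Definition Godd (tau : V -> V) : rel V :=
  [rel v w | arc v w && ((v \notin even_node G) ==> (w == tau v))].

Definition Geven (sigma : V -> V) : rel V :=
  [rel v w | arc v w && ((v \in even_node G) ==> (w == sigma v))].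

(* A (simple) cycle is the duplicate-free sequence of its nodes. *)
Definition is_cycle (H : rel V) c : bool := (c != [::]) && ucycleb H c.

Definition cycle_arcs c : rel V := [rel v w | (v \in c) && (w == next c v)].

Definition cycle_prio c : nat := (\max_(v <- c) prio v)%N.

Definition dominates v c : bool := (v \in c) && (prio v == cycle_prio c).

Definition base_node (H : rel V) v : Prop :=
  exists c, [/\ is_cycle H c, ~~ odd (cycle_prio c) & dominates v c].

Section Labeling.
Context (disp : Order.disp_t) (M : orderType disp) (T : set (seqlexi M)).
Notation labeling := (V -> label T).
Implicit Types (mu nu : labeling) (xi : label T) (H : rel V).

Definition le_labeling mu nu : Prop := forall v, mu v <= nu v.

Definition truncp (p : nat) xi := trunc (maxprio G)./2 p xi.

Definition nonviolated mu v w : bool :=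
  if odd (prio v) then
    (truncp (prio v) (mu w) < truncp (prio v) (mu v))
    || (mu v == \top) && (mu w == \top)
  else truncp (prio v) (mu w) <= truncp (prio v) (mu v).

(* If [v = w], the replacement changes the label at both ends of the arc. *)
Definition tight mu v w : Prop :=
  is_least (fun xi => nonviolated [eta mu with v |-> xi] v w) (mu v).

Definition loose mu v w : Prop := nonviolated mu v w /\ ~ tight mu v w.

Definition feasible mu H : Prop :=
  exists sigma : V -> V,
    [/\ even_strategy sigma,
        forall v, v \in even_node G -> (exists w, H v w) -> H v (sigma v) &
        forall v w, H v w -> Geven sigma v w -> nonviolated mu v w].

Definition least_feasible_above mu H nu : Prop :=
  [/\ le_labeling mu nu, feasible nu H &
      forall nu', le_labeling mu nu' -> feasible nu' H -> le_labeling nu nu'].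

Definition is_drop nu v w xi : Prop :=
  is_greatest (fun xi => xi <= nu v /\ ~ loose [eta nu with v |-> xi] v w) xi.

(* The fallback value [nu v] is only used if there is no largest such label,  *)
(* which cannot happen in a finite tree.                                      *)
Definition drop_label nu v w : label T := xget (nu v) [set xi | is_drop nu v w xi]%classic.

Definition relax nu (a : V * V) : labeling :=
  [eta nu with a.1 |-> drop_label nu a.1 a.2].

(* [orders] lists, for each of the successive rounds, the order in which the  *)
(* arcs are processed.                                                        *)
Definition bellman_ford nu (orders : seq (seq (V * V))) : labeling :=
  foldl (foldl relax) nu orders.

Definition bellman_ford_orders H (orders : seq (seq (V * V))) : bool :=
  (size orders == #|V|.-1) &&
  all (fun s => perm_eq s (enum [pred a : V * V | H a.1 a.2])) orders.

Definition is_threshold mu H v xi : Prop :=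
  is_least
    (fun x => exists mu' : labeling,
       [/\ mu' v = x, mu v <= mu' v &
           exists c, [/\ is_cycle H c, dominates v c &
                         feasible mu' (cycle_arcs c)]])
    xi.

End Labeling.
End Game.

(* Main.v *)
(* Follow the strategy that makes [mu_up] feasible, together with [tau], from
   any node. The walk ends in a cycle. If the cycle is odd, all its labels are
   top, and so is the label of the starting node. If it is even, a dominating
   node u is a base node and [mu_up] itself witnesses that the threshold of u
   is at most [mu_up u], so [nu u = mu_up u] from the start. No arc of
   [Godd tau] is loose with respect to [mu_up]; this keeps [nu] above [mu_up],
   and it makes the arcs of the walk tight, so that every round fixes one more
   node of the path, of length at most n - 1, that leads to u. *)
Require Import Defs.
From mathcomp Require Import all_boot all_order.
From mathcomp Require Import boolp classical_sets.

Set Implicit Arguments.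
Unset Strict Implicit.
Unset Printing Implicit Defensive.

Import Order.TTheory.

(** * Lexicographic truncations, violation and looseness *)

Lemma le_take_lexi disp (M : orderType disp) k (s t : seqlexi M) :
  (s <= t)%O -> ((take k s : seqlexi M) <= (take k t : seqlexi M))%O.
Proof.
elim: s t k => [|x s IH] [|y t] [|k] //=.
rewrite !lexi_cons => /andP[-> /implyP xy].
by apply/implyP => /xy; apply: IH.
Qed.

Section Labelings.
Local Open Scope order_scope.
Context (G : parity_game) (disp : Order.disp_t) (M : orderType disp).
Context (T : set (seqlexi M)).
Notation V := (node G).
Implicit Types (m l : V -> label T) (x y : label T) (u v w : V).
Implicit Types orders : seq (seq (V * V)).

Lemma le_truncp p x y : x <= y -> truncp G p x <= truncp G p y.
Proof. by case: x y => [x|] [y|] //=; apply: le_take_lexi. Qed.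

(** The larger index deletes more components, so the [p]-truncations are prefixes of the
    [q]-truncations. *)
Lemma le_truncpW p q x y : (q <= p)%N ->
  truncp G q x <= truncp G q y -> truncp G p x <= truncp G p y.
Proof.
move=> qp; case: x y => [x|] [y|] //= xy.
have kl : (((maxprio G)./2.*2.+1 - p)./2 <= ((maxprio G)./2.*2.+1 - q)./2)%N.
  by rewrite half_leq // leq_sub2l.
rewrite -(take_takel (leaf_val x) kl) -(take_takel (leaf_val y) kl).
exact: le_take_lexi.
Qed.

Lemma top_truncp p x : (\top <= truncp G p x) = (x == \top).
Proof. by case: x. Qed.

(** At a self-loop the head moves with the tail: an even priority never violates it, and an odd one
    requires [\top], which survives raising. Hence [l w <= m w] is asked only for [w != v]. *)
Lemma nonviolated_raise m l v w :
  m v <= l v -> (w != v -> l w <= m w) ->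
  nonviolated m v w -> nonviolated l v w.
Proof.
rewrite /nonviolated => mv.
have topv : m v == \top -> l v == \top.
  by move=> /eqP mvT; rewrite -le1x -mvT.
have [-> _|_ /(_ isT) mw] := eqVneq w v.
  case: ifP => [_|_ _]; last exact: lexx.
  by rewrite !ltxx /= !andbb.
case: ifP => _; last first.
  move=> vw; apply: le_trans (le_trans vw _); exact: le_truncp.
case/orP => [vw|/andP[/topv /eqP-> _]].
  apply/orP; left; apply: le_lt_trans (lt_le_trans vw _); exact: le_truncp.
by rewrite eqxx /=; case: (l w) => [z|].
Qed.

Lemma looseP m v w :
  loose m v w <->
  nonviolated m v w /\
  exists2 x, x < m v & nonviolated [eta m with v |-> x] v w.
Proof.
have same : [eta m with v |-> m v] =1 m.
  by move=> z /=; case: eqP => [->|].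
have nvE : nonviolated [eta m with v |-> m v] v w = nonviolated m v w.
  by rewrite /nonviolated !same.
split=> [[nv ntight]|[nv [x xm nvx]]]; split=> //; last first.
  by case=> _ /(_ _ nvx); rewrite leNgt xm.
apply: contrapT => nox; apply: ntight; split; first by rewrite nvE.
move=> y nvy; rewrite leNgt; apply/negP => ym; apply: nox; by exists y.
Qed.

(** Both the non-violation and the smaller label that witnesses looseness survive lowering the
    head. *)
Lemma loose_lower_target m l v w :
  m v = l v -> m w <= l w -> loose l v w -> loose m v w.
Proof.
move=> mv mw /looseP[nv [x xm nvx]]; apply/looseP; split.
  by apply: nonviolated_raise nv; rewrite ?mv.
exists x; first by rewrite mv.
by apply: nonviolated_raise nvx; rewrite /= ?eqxx // => /negPf->.
Qed.

(** * Drops and single relaxations *)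

Lemma is_drop_label m v w x : is_drop m v w x -> drop_label m v w = x.
Proof.
move=> xdrop; apply: xget_subset1 xdrop _ => y z [ym ymax] [zm zmax].
by apply: le_anti; rewrite zmax // ymax.
Qed.

Lemma drop_label_le m v w : drop_label m v w <= m v.
Proof. by rewrite /drop_label; case: xgetP => // x _ [[]]. Qed.

(** The label [m v] competes in the maximum that defines the drop: placed at [v], it makes the arc
    loose in [l] only if it was loose in [m]. The fallback [l v] is above [m v] anyway. *)
Lemma drop_label_ge m l v w :
  le_labeling m l -> ~ loose m v w -> m v <= drop_label l v w.
Proof.
move=> le_ml nl; rewrite /drop_label; case: xgetP => [x _ [_]|_];
  last exact: le_ml.
apply; split; first exact: le_ml.
apply: contra_not nl; apply: loose_lower_target; first by rewrite /= eqxx.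
by rewrite /=; case: eqP => [->|_].
Qed.

Lemma drop_label_tight m l v w :
  w != v -> le_labeling m l -> l w = m w ->
  nonviolated m v w -> ~ loose m v w -> drop_label l v w = m v.
Proof.
move=> wv le_ml mw nv nl; apply: is_drop_label; split.
  split; first exact: le_ml.
  apply: contra_not nl; apply: loose_lower_target => /=; first by rewrite eqxx.
  by rewrite (negPf wv) mw.
(* Any label above [m v] leaves the arc loose, with [m v] as the smaller non-violating label. *)
move=> x [_ nlx]; rewrite leNgt; apply/negP => mx; apply: nlx.
apply/looseP; split.
  apply: nonviolated_raise nv => /=; first by rewrite eqxx ltW.
  by rewrite (negPf wv) mw.
exists (m v); first by rewrite /= eqxx.
apply: nonviolated_raise nv => /=; first by rewrite eqxx.
by rewrite (negPf wv) mw.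
Qed.

Lemma relax_le m a : le_labeling (relax m a) m.
Proof.
by move=> v; rewrite /relax /=; case: eqP => // ->; apply: drop_label_le.
Qed.

Lemma relax_ge m l a :
  le_labeling m l -> ~ loose m a.1 a.2 -> le_labeling m (relax l a).
Proof.
move=> le_ml nl v; rewrite /relax /=.
by case: eqP => // ->; apply: drop_label_ge.
Qed.

(** * Rounds of relaxations *)

Lemma round_le m s : le_labeling (foldl (@relax G disp M T) m s) m.
Proof.
elim: s m => [|a s IH] m v //=; exact: le_trans (IH _ v) (relax_le _ _ _).
Qed.

Lemma round_ge m l s :
  le_labeling m l -> {in s, forall a, ~ loose m a.1 a.2} ->
  le_labeling m (foldl (@relax G disp M T) l s).
Proof.
elim: s l => [|a s IH] l le_ml //= nl; apply: IH => [|b bs].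
  by apply: relax_ge => //; apply: nl; rewrite mem_head.
by apply: nl; rewrite inE bs orbT.
Qed.

Lemma round_fixed m l s v :
  le_labeling m l -> {in s, forall a, ~ loose m a.1 a.2} ->
  l v = m v -> foldl (@relax G disp M T) l s v = m v.
Proof.
move=> le_ml nl mv; apply: le_anti.
by rewrite (round_ge le_ml nl) -mv round_le.
Qed.

Lemma round_tight m l s v w :
  le_labeling m l -> {in s, forall a, ~ loose m a.1 a.2} ->
  (v, w) \in s -> nonviolated m v w -> l w = m w ->
  foldl (@relax G disp M T) l s v = m v.
Proof.
move=> le_ml nl vws nv mw.
have [wv|wv] := eqVneq w v; first by apply: round_fixed; rewrite // -wv.
have vwl : ~ loose m v w by apply: nl vws.
case/splitPr: vws nl => s1 s2 nl.
have nl1 : {in s1, forall a, ~ loose m a.1 a.2}.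
  by move=> a as1; apply: nl; rewrite mem_cat as1.
have nl2 : {in s2, forall a, ~ loose m a.1 a.2}.
  by move=> a as2; apply: nl; rewrite mem_cat inE as2 !orbT.
have ge1 := round_ge le_ml nl1.
(* Relaxations before [(v, w)] keep the label of [w], the one at [(v, w)] sets [v] to [m v], and
   later ones keep it there. *)
rewrite foldl_cat /=; apply: round_fixed => //.
  exact: (@relax_ge _ _ (v, w)).
rewrite /relax /= eqxx; apply: drop_label_tight => //.
exact: round_fixed.
Qed.

Lemma bellman_ford_ge m l orders :
  le_labeling m l ->
  {in orders, forall s, {in s, forall a, ~ loose m a.1 a.2}} ->
  le_labeling m (bellman_ford l orders).
Proof.
rewrite /bellman_ford; elim: orders l => [|s o IH] l le_ml //= nl.
apply: IH => [|t ot].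
  by apply: round_ge => //; apply: nl; rewrite mem_head.
by apply: nl; rewrite inE ot orbT.
Qed.

(** Each round makes the preceding node of the path exact, so the distance [k] to an exact node
    falls along with the number of rounds left. *)
Lemma bellman_ford_path m l orders (f : V -> V) k v :
  le_labeling m l ->
  {in orders, forall s, {in s, forall a, ~ loose m a.1 a.2}} ->
  {in orders, forall s u, (u, f u) \in s} ->
  (forall u, nonviolated m u (f u)) ->
  (k <= size orders)%N -> l (iter k f v) = m (iter k f v) ->
  bellman_ford l orders v = m v.
Proof.
rewrite /bellman_ford => le_ml nl fs nv.
elim: orders l k le_ml nl fs => [|s o IH] l k le_ml nl fs /=.
  by case: k.
move=> kn mk.
have sso : s \in s :: o by rewrite mem_head.
have sub t : t \in o -> t \in s :: o by rewrite inE => ->; rewrite orbT.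
(* The predecessor also covers [k = 0], where [v] is exact and stays so. *)
apply: (IH _ k.-1) => [|t /sub/nl//|t /sub/fs//||].
- by apply: round_ge => //; apply: nl.
- by case: k kn {mk}.
case: k {kn} mk => [|k] mk /=; first by apply: round_fixed (nl _ sso) mk.
exact: round_tight (nl _ sso) (fs _ sso _) (nv _) mk.
Qed.

(* If [v w] were loose, lowering the label of [v] and letting Even move from
   [v] to [w] would keep feasibility. *)
Lemma least_feasible_not_loose (tau : V -> V) m l :
  (forall v w, Godd tau v w -> ~ loose m v w) ->
  least_feasible_above m (Godd tau) l ->
  forall v w, Godd tau v w -> ~ loose l v w.
Proof.
move=> nl [le_ml [sigma [sigmaE _ nv]] least] v w vw lvw.
have [mv|mv] := eqVneq (m v) (l v).
  exact: nl vw (loose_lower_target mv (le_ml w) lvw).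
have{mv} mv : m v < l v by rewrite lt_neqAle mv le_ml.
case/looseP: lvw => _ [x xm nvx].
(* The maximum with [m v] keeps the lowered labeling above [m], as leastness requires; being at
   least [x], it still does not violate the arc. *)
pose z : label T := Order.max x (m v).
have zm : z < l v by rewrite gt_max xm.
suff /(_ v): le_labeling l [eta l with v |-> z] by rewrite /= eqxx leNgt zm.
apply: least => [u /=|]; first by case: eqP => // ->; rewrite le_max lexx orbT.
have arcvw : Defs.arc v w by case/andP: vw.
exists [eta sigma with v |-> w]; split=> [u uE|u uE [u' uu']|a b ab sab] /=.
- by case: eqP => [->//|_]; apply: sigmaE.
- by case: eqP => [->//|_]; rewrite /Godd /= uE /= andbT sigmaE.
have [av|av] := eqVneq a v.
  rewrite {}av in ab sab *.
  (* Only [w] is left as a successor of [v]: the modified Even strategy picks it, or [tau] does. *)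
  have -> : b = w.
    case: (boolP (v \in even_node G)) => vE.
      by move: sab; rewrite /Geven /= vE eqxx => /andP[_ /eqP].
    by move: ab vw; rewrite /Godd /= vE /= => /andP[_ /eqP->] /andP[_ /eqP->].
  apply: nonviolated_raise nvx => /=; first by rewrite eqxx le_max lexx.
  by move=> /negPf->.
have nvab : nonviolated l a b.
  by apply: nv => //; move: sab; rewrite /Geven /= (negPf av).
apply: nonviolated_raise nvab => /=; first by rewrite (negPf av).
by move=> _; case: eqP => // ->; apply: ltW.
Qed.

Lemma iter_nonviolated_top m (f : V -> V) k v :
  (forall u, nonviolated m u (f u)) -> m (iter k f v) = \top -> m v = \top.
Proof.
move=> nv; elim: k => //= k IH fk; apply: IH.
move: (nv (iter k f v)); rewrite /nonviolated fk; case: ifP => _.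
  by case/orP => [|/andP[/eqP]//]; case: (m _).
by rewrite top_truncp => /eqP.
Qed.

(* Along an odd cycle, truncations at the dominating priority never increase,
   and they strictly decrease after the dominating node unless it is top. *)
Lemma odd_cycle_top m (f : V -> V) u k :
  (forall w, nonviolated m w (f w)) -> iter k.+1 f u = u -> odd (prio u) ->
  (forall j, (prio (iter j f u) <= prio u)%N) -> m u = \top.
Proof.
move=> nv fu oddu le_u.
have step j : truncp G (prio u) (m (iter j f (f u))) <=
              truncp G (prio u) (m (f u)).
  elim: j => //= j /(le_trans _); apply.
  apply: (@le_truncpW _ (prio (iter j f (f u)))); first by rewrite -iterSr.
  move: (nv (iter j f (f u))); rewrite /nonviolated; case: ifP => // _.
  by case/orP => [/ltW//|/andP[/eqP-> /eqP->]].
move: (nv u); rewrite /nonviolated oddu => /orP[|/andP[/eqP//]].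
(* The cycle closes at [j = k]: the truncation at [u] is at most that at [f u], against the strict
   decrease. *)
by move: (step k); rewrite -iterSr fu leNgt => /negPf->.
Qed.

End Labelings.

(** * Cycles reached by iterating a self-map *)

Lemma iter_cycle_exists (V : finType) (f : V -> V) v :
  exists2 u, fconnect f v u & fcycle f (orbit f u).
Proof.
have : looping f v #|V|.
  rewrite -[looping _ _ _]negbK -looping_uniq.
  apply/negP => /card_uniqP card_traject.
  have := max_card (mem (traject f v #|V|.+1)).
  by rewrite card_traject size_traject ltnn.
case/trajectP => i lt_i eq_i; exists (iter i f v); first exact: fconnect_iter.
(* Iterate [i] recurs at step [#|V|], so [#|V| - i] is a period; the criterion asks for its
   predecessor. *)
apply/(orbitPcycle 3 0); exists (#|V| - i).-1.
by rewrite prednK ?subn_gt0 // -iterD subnK // ltnW.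
Qed.

(** The nodes reachable from a node of a cycle of [f] form that cycle, so one of maximal priority
    among them dominates it. *)
Lemma fcycle_dominating_node (G : parity_game) (f : node G -> node G) v :
  exists u, [/\ fconnect f v u, fcycle f (orbit f u) &
                dominates u (orbit f u)].
Proof.
have [y vy cy] := iter_cycle_exists f v.
case: (arg_maxnP (@prio G) (connect0 (frel f) y)) => u yu umax.
exists u; split.
- exact: connect_trans vy yu.
- by apply: cycle_orbit_cycle cy _ _; rewrite -fconnect_orbit.
rewrite /dominates in_orbit /= /cycle_prio eqn_leq leq_bigmax_seq ?in_orbit //=.
apply/bigmax_leqP_seq => w uw _; apply: umax.
by apply: connect_trans yu _; rewrite fconnect_orbit.
Qed.

Theorem theorem4p3 (G : parity_game) (tau : node G -> node G)
    (disp : Order.disp_t) (M : orderType disp) (T : set (seqlexi M))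
    (mu mu_up nu : node G -> label T) (orders : seq (seq (node G * node G))) :
  odd_strategy tau ->
  universal_tree #|node G| (maxprio G)./2 T ->
  (forall v w, Godd tau v w -> ~ loose mu v w) ->
  least_feasible_above mu (Godd tau) mu_up ->
  le_labeling mu_up nu ->
  (forall v, base_node (Godd tau) v ->
     exists2 xi, is_threshold mu (Godd tau) v xi & (nu v <= xi)%O) ->
  bellman_ford_orders (Godd tau) orders ->
  bellman_ford nu orders =1 mu_up.
Proof.
move=> tauO _ nl least le_nu base /andP[/eqP size_o /allP perm_o] v.
have nl_up := least_feasible_not_loose nl least.
have mem_o s a : s \in orders -> (a \in s) = Godd tau a.1 a.2.
  by move=> /perm_o /perm_mem ->; rewrite mem_enum.
have nl_o : {in orders, forall s, {in s, forall a, ~ loose mu_up a.1 a.2}}.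
  by move=> s so a; rewrite (mem_o s) // => /nl_up.
have [mu_le [sigma [sigmaE _ nv_sigma]] _] := least.
pose f u := if u \in even_node G then sigma u else tau u.
have f_odd u : Godd tau u (f u).
  rewrite /Godd /f; case: ifPn => uE /=; first by rewrite uE andbT sigmaE.
  by rewrite uE eqxx andbT tauO.
have f_arc u : Defs.arc u (f u) by case/andP: (f_odd u).
have f_even u : Geven sigma u (f u).
  by rewrite /Geven /= f_arc /f; case: ifP => //=; rewrite eqxx.
have nv u : nonviolated mu_up u (f u) by apply: nv_sigma.
have [u [vu cu domu]] := fcycle_dominating_node f v.
have is_u : is_cycle (Godd tau) (orbit f u).
  rewrite /is_cycle /ucycleb orbit_uniq andbT -size_eq0 size_orbit -lt0n.
  rewrite order_gt0.
  by apply: sub_cycle cu => x y /eqP <-.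
have prio_u : prio u = cycle_prio (orbit f u) by case/andP: domu => _ /eqP.
case: (boolP (odd (prio u))) => [odd_u|even_u].
  have [k fku] : exists k, iter k.+1 f u = u by apply/(orbitPcycle 0 3).
  have topu : mu_up u = \top%O.
    apply: odd_cycle_top fku odd_u _ => // j; rewrite prio_u.
    by apply: leq_bigmax_seq; rewrite // -fconnect_orbit fconnect_iter.
  have topv : mu_up v = \top%O.
    apply: (iter_nonviolated_top (k := findex f v u) nv).
    by rewrite iter_findex.
  apply/eqP; rewrite topv -le1x -topv.
  exact: bellman_ford_ge.
have nu_u : nu u = mu_up u.
  have [|xi [_ xi_min] le_xi] := base u.
    by exists (orbit f u); rewrite -prio_u.
  apply: le_anti; rewrite le_nu andbT; apply: le_trans le_xi _.
  apply: xi_min; exists mu_up; split=> //.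
  exists (orbit f u); split=> //.
  (* On the orbit [next] agrees with [f], so [sigma] stays on the cycle and [nv] covers all its
     arcs. *)
  exists sigma; split=> // [w wE [w' /andP[ww' _]]|].
    rewrite /cycle_arcs /= ww' -(eqP (next_cycle cu ww')).
    by rewrite /f wE eqxx.
  by move=> w w' /andP[wu /eqP->] _; rewrite -(eqP (next_cycle cu wu)).
apply: (bellman_ford_path (k := findex f v u) (f := f)) => //.
- by move=> s so w; rewrite (mem_o s).
(* The distance is below the orbit size of [v], hence at most [n - 1], the number of rounds. *)
- have lt_n : findex f v u < #|node G|.
    exact: leq_trans (findex_max vu) (max_card _).
  by rewrite size_o -ltnS prednK // (leq_trans _ lt_n).
by rewrite iter_findex.
Qed.
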